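(* Let $m\in\mathbb{N}$. For any partial function $f:\subseteq\mathrm{Reg}\to\mathrm{Reg}$ computable by an oracle Turing machine with running time bounded by a second-order polynomial $P$ with $\deg(P)\le m$, there are $\psi\in\mathrm{Reg}$ and $n,l\in\mathbb{N}$ such that for every $\varphi\in\mathrm{dom}(f)$ we have $f(\varphi)=M^{T=P_m}(\langle n,\langle\varphi,\psi\rangle,x^l\rangle)$, i.e. for every string $w$ the clocked machine $M^{T=P_m}$ with index $n$, oracle $\langle\varphi,\psi\rangle$, exponent $l$ and input $w$ outputs $f(\varphi)(w)$.
   Context: Fix a finite alphabet $\Sigma$. A total function $\varphi:\Sigma^*\to\Sigma^*$ is regular if $|u|\le|v|$ implies $|\varphi(u)|\le|\varphi(v)|$; its size $|\varphi|$ is given by $|\varphi|(|u|)=|\varphi(u)|$. Let $\mathrm{mon}$ be the set of strictly monotone functions $\mathbb{N}\to\mathbb{N}$ and $\mathrm{Reg}$ the set of regular $\varphi$ with $|\varphi|\in\mathrm{mon}$. A polynomial-time pairing $\langle\cdot,\cdot\rangle$ on strings with $|\langle u,v\rangle|=|u|\cdot|v|$ is lifted to $\mathrm{Reg}$ pointwise, $\langle\varphi,\psi\rangle(u)=\langle\varphi(u),\psi(u)\rangle$, and to a mixed pairing of a string (or number) with an element of $\mathrm{Reg}$. Second-order polynomials in $\mathtt{L}$ (type 1) and $\mathtt{n}$ (type 0) are built from positive integers and $\mathtt{n}$ by $+$, $\cdot$ and $\mathtt{L}(\cdot)$; $P(p)(k)$ is evaluation at $\mathtt{L}:=p\in\mathrm{mon}$,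 $\mathtt{n}:=k$. An oracle machine computes $f:\subseteq\mathrm{Reg}\to\mathrm{Reg}$ if on oracle $\varphi\in\mathrm{dom}f$ and input $u$ it outputs $f(\varphi)(u)$; its running time is bounded by $P$ if it halts within $P(|\varphi|)(|u|)$ steps for every oracle $\varphi\in\mathrm{Reg}$ and input $u$. Second-order degree: $\deg$ is defined with an auxiliary type in $\{\mathbf{a},\mathbf{m}\}$: constants and $\mathtt{n}$ have degree $0$ and type $\mathbf{m}$; $\deg\mathtt{L}(P)=\deg P+1$, type $\mathbf{a}$; for $P+Q$, $P\cdot Q$ let $d=\max\{\deg P,\deg Q\}$ and call the pair critical if one of $P,Q$ has type $\mathbf{a}$ and degree $d$; $\deg(P+Q)=d$ with type $\mathbf{a}$ if critical, $\mathbf{m}$ otherwise; $\deg(P\cdot Q)=d+1$ if critical, $d$ otherwise, type $\mathbf{m}$. Let $P_0(p)(k)=k$ and $P_{j+1}(p)(k)=p(P_j(p)(k))$. Clocked machine: fix a universal oracle Turing machine $M$ that simulates efficiently: given an index $n$, oracle $\varphi$ and input $w$, the time $M$ needs to produce the output of the $n$-th oracle Turing machine on input $w$ with oracle $\varphi$ is bounded by a quadratic polynomial in $n$ and the time that $n$-th machine itself needs. $M^{T=P_m}$ is $M$ extended by a clock: on index $n$, oracle $\varphi'$, parameter $l$ (encoded as the function $x\mapsto x^l\in\mathrm{mon}$) and input $w$, it evaluates $P_m(|\langle n,\varphi'\rangle|)(|w|^l)$ and aborts the simulation once the simulation time exceeds this value; otherwise it outputs what $M$ outputs.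
   Formalization: The clocked equality is claimed only for |w| ≥ 2 (for shorter w, M outputs f(φ)(w) unclocked), as |w|^l does not grow there; M's overhead is quadratic in n but linear in the simulated time; one concrete pairing with |⟨u,v⟩|=|u||v| is fixed; Σ has at least two letters. *)

(* Defs.v *)
From mathcomp Require Import all_boot.
From mathcomp Require Import zify.

Set Implicit Arguments.
Unset Strict Implicit.
Unset Printing Implicit Defensive.

Definition mon (p : nat -> nat) : Prop := forall j k, j < k -> p j < p k.

(** * Second-order polynomials *)

Inductive sopoly : Type :=
| SOconst c of 0 < c
| SOvar
| SOadd of sopoly & sopoly
| SOmul of sopoly & sopoly
| SOL of sopoly.

Fixpoint soeval (P : sopoly) (p : nat -> nat) (k : nat) : nat :=
  match P with
  | SOconst c _ => c
  | SOvar => k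
  | SOadd Q R => soeval Q p k + soeval R p k
  | SOmul Q R => soeval Q p k * soeval R p k
  | SOL Q => p (soeval Q p k)
  end.

Inductive sotype := TypeA | TypeM.

Definition is_typeA (a : sotype) : bool := if a is TypeA then true else false.

Definition critical (x y : nat * sotype) : bool :=
  let d := maxn x.1 y.1 in
  (is_typeA x.2 && (x.1 == d)) || (is_typeA y.2 && (y.1 == d)).

Fixpoint sodegtype (P : sopoly) : nat * sotype :=
  match P with
  | SOconst _ _ | SOvar => (0, TypeM)
  | SOL Q => ((sodegtype Q).1.+1, TypeA)
  | SOadd Q R =>
      let x := sodegtype Q in let y := sodegtype R in
      (maxn x.1 y.1, if critical x y then TypeA else TypeM)
  | SOmul Q R =>
      let x := sodegtype Q in let y := sodegtype R in
      (if critical x y then (maxn x.1 y.1).+1 else maxn x.1 y.1, TypeM)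
  end.

Definition sodeg (P : sopoly) : nat := (sodegtype P).1.

(** [Piter j] is P_j: P_0(p)(k) = k and P_{j+1}(p)(k) = p(P_j(p)(k)). *)
Definition Piter (j : nat) : sopoly := iter j SOL SOvar.

(** * Strings and regular functions *)

Section Strings.

(* [a0] and [a1] are two distinct letters, used as the binary digits. *)
Variables (Sigma : finType) (a0 a1 : Sigma).

Local Notation str := (seq Sigma).

Definition regular (phi : str -> str) : Prop :=
  forall u v, size u <= size v -> size (phi u) <= size (phi v).

(* For regular [phi] the length of [phi u] only depends on that of [u], so the
   choice of the word [a0 ... a0] is immaterial. *)
Definition fsize (phi : str -> str) (k : nat) : nat := size (phi (nseq k a0)).

Definition Reg (phi : str -> str) : Prop := regular phi /\ mon (fsize phi).

(** ** Pairing *)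

(* The self-delimiting code  a1 u_1 a1 u_2 ... a1 u_k a0  of  u_1 ... u_k. *)
Fixpoint code (u : str) : str :=
  if u is x :: u' then [:: a1, x & code u'] else [:: a0].

(* The codes of the components, padded (or, for very short components, cut) to
   length |u| * |v|.  No pairing with this length is injective on all pairs: for
   |u| = 1 there are more pairs than words of length |v|.  The projections below
   recover u whenever |v| >= 3, and v whenever the two codes fit. *)
Definition spair (u v : str) : str :=
  let N := size u * size v in take N (code u ++ code v ++ nseq N a0).

Fixpoint decode (s : str) : str :=
  if s is [:: b, x & s'] then if b == a1 then x :: decode s' else [::] else [::].

Definition proj1 (s : str) : str := decode s.
Definition proj2 (s : str) : str := decode (drop (size (proj1 s)).*2.+1 s).

Lemma size_code u : size (code u) = (size u).*2.+1.
Proof. by elim: u => //= x u ->. Qed.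

Lemma size_spair u v : size (spair u v) = size u * size v.
Proof.
by rewrite size_takel // !size_cat size_nseq addnA leq_addl.
Qed.

Lemma decode_code (h : a0 != a1) u s : decode (code u ++ s) = u.
Proof.
elim: u => [|x u IHu] /=; last by rewrite eqxx IHu.
by case: s => //= x s; rewrite (negbTE h).
Qed.

Lemma spairK1 (h : a0 != a1) u v : 2 < size v -> proj1 (spair u v) = u.
Proof.
case: u => [|x u] hv; first by rewrite /spair mul0n take0.
have hs : size (code (x :: u)) <= size (x :: u) * size v.
  by rewrite size_code /=; nia.
by rewrite /proj1 /spair take_cat ltnNge hs; apply: decode_code.
Qed.

Lemma spairK2 (h : a0 != a1) u v :
  size (code u) + size (code v) <= size u * size v -> proj2 (spair u v) = v.
Proof.
move=> hs.
have e : exists r, spair u v = code u ++ code v ++ r.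
  exists (take (size u * size v - size (code u) - size (code v))
            (nseq (size u * size v) a0)).
  by rewrite /spair take_cat ltnNge (leq_trans (leq_addr _ _) hs) /= take_cat
             ltnNge leq_subRL ?hs // (leq_trans (leq_addr _ _) hs).
have [r ->] := e.
by rewrite /proj2 /proj1 decode_code // -size_code drop_size_cat ?decode_code.
Qed.

Definition pairf (phi psi : str -> str) : str -> str :=
  fun u => spair (phi u) (psi u).

(* Binary numeral of [n], least significant digit first, never empty. *)
Definition numeral (n : nat) : str :=
  mkseq (fun i => if odd (n %/ 2 ^ i) then a1 else a0) (trunc_log 2 n).+1.

Definition pairn (n : nat) (phi : str -> str) : str -> str :=
  fun u => spair (numeral n) (phi u).

End Strings.

(** * Oracle Turing machines *)

(* A machine has a two-way read-only input tape, a two-way read-only answer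
   tape, a two-way infinite work tape, and write-only query and output tapes.
   Every transition, including an oracle call, costs one step, whatever the
   length of the answer.  The numbers of states
   and of work symbols depend on the machine, the number of tapes does not. *)

Inductive move := MLeft | MStay | MRight.

Section Machines.

Variable Sigma : finType.

Local Notation str := (seq Sigma).

Record instr (s g : nat) := Instr {
  next_state : 'I_s;
  in_move : move;
  ans_move : move;
  work_write : 'I_g;
  work_move : move;
  query_put : option Sigma;
  out_put : option Sigma;
  ask : bool (* submit the query tape to the oracle *)
}.

(* The transition function reads state, input symbol, answer symbol and work
   symbol; [None] as a transition means that the machine halts. *)
Record otm := OTM {
  nstates : nat;
  nsyms : nat;
  start_state : 'I_nstates;
  blank_sym : 'I_nsyms;
  delta : {ffun 'I_nstates * option Sigma * option Sigma * 'I_nsyms ->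
                option (instr nstates nsyms)}
}.

(* Read-only tapes: the word occupies cells 1, ..., |s|, the head is confined to
   the cells 0, ..., |s|+1, and the two end cells read [None]. *)
Record rotape := ROTape { ro_word : str; ro_pos : nat }.

Definition ro_init (s : str) : rotape := ROTape s 1.

Definition ro_read (T : rotape) : option Sigma :=
  nth None (None :: map Some (ro_word T)) (ro_pos T).

Definition ro_move (d : move) (T : rotape) : rotape :=
  let: ROTape s p := T in
  ROTape s (match d with
            | MLeft => p.-1
            | MStay => p
            | MRight => minn p.+1 (size s).+1
            end).

(* Work tapes: cells to the left of the head (nearest first), scanned cell,
   cells to the right; all cells not listed are blank. *)
Record wtape (g : nat) := WTape { wleft : seq 'I_g; wcur : 'I_g; wright : seq 'I_g }.

Definition w_move (g : nat) (b : 'I_g) (d : move) (T : wtape g) : wtape g :=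
  let: WTape l c r := T in
  match d with
  | MLeft => WTape (behead l) (head b l) (c :: r)
  | MStay => T
  | MRight => WTape (c :: l) (head b r) (behead r)
  end.

Definition w_write (g : nat) (c : 'I_g) (T : wtape g) : wtape g :=
  WTape (wleft T) c (wright T).

Record config (N : otm) := Config {
  c_state : 'I_(nstates N);
  c_in : rotape;
  c_ans : rotape;
  c_work : wtape (nsyms N);
  c_query : str;
  c_out : str
}.

Definition init_config (N : otm) (w : str) : config N :=
  Config (start_state N) (ro_init w) (ro_init [::])
         (WTape [::] (blank_sym N) [::]) [::] [::].

Definition put (x : option Sigma) (s : str) : str :=
  if x is Some a then rcons s a else s.

(* On an oracle call the query tape is erased, and the answer tape is replaced
   by the answer with the head on its first letter. *)
Definition step (N : otm) (phi : str -> str) (c : config N) : option (config N) :=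
  if delta N (c_state c, ro_read (c_in c), ro_read (c_ans c), wcur (c_work c))
    is Some i then
    let q := put (query_put i) (c_query c) in
    Some (Config (next_state i)
            (ro_move (in_move i) (c_in c))
            (if ask i then ro_init (phi q) else ro_move (ans_move i) (c_ans c))
            (w_move (blank_sym N) (work_move i) (w_write (work_write i) (c_work c)))
            (if ask i then [::] else q)
            (put (out_put i) (c_out c)))
  else None.

Fixpoint run_from (N : otm) (phi : str -> str) (t : nat) (c : config N) : option str :=
  match step phi c, t with
  | None, _ => Some (c_out c)
  | Some _, 0 => None
  | Some c', t'.+1 => run_from phi t' c'
  end.

(* [run N phi t w] is [Some v] if [N] with oracle [phi] on input [w] halts within
   [t] steps with output [v], and [None] if it is still running after [t] steps. *)
Definition run (N : otm) (phi : str -> str) (t : nat) (w : str) : option str :=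
  run_from phi t (init_config N w).

Definition outputs (N : otm) (phi : str -> str) (w v : str) : Prop :=
  exists t, run N phi t w = Some v.

Definition computes (N : otm) (dom : (str -> str) -> Prop)
    (f : (str -> str) -> (str -> str)) : Prop :=
  forall phi, dom phi -> forall u, outputs N phi u (f phi u).

Definition time_bounded (a0 : Sigma) (N : otm) (P : sopoly) : Prop :=
  forall phi u, Reg a0 phi ->
    exists v, run N phi (soeval P (fsize a0 phi) (size u)) u = Some v.

(** * Universal and clocked machines *)

(* [mach] lists all machines, and [enc n w] is the word by which the index [n]
   together with the input [w] is presented to the universal machine. *)

Definition numbering (mach : nat -> otm) : Prop := forall N, exists n, mach n = N.

Definition universal (a0 : Sigma) (mach : nat -> otm) (enc : nat -> str -> str)
    (M : otm) : Prop :=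
  forall n phi w v, Reg a0 phi ->
    outputs M phi (enc n w) v <-> outputs (mach n) phi w v.

(* Quadratic in [n] and linear in the time [t] of the simulated machine; this
   covers every quadratic polynomial in [n] and [t] without a [t ^ 2] term.  A
   [t ^ 2] overhead cannot be absorbed by a clock of the same degree, as [L * L]
   has higher degree than [L]. *)
Definition efficient (a0 : Sigma) (mach : nat -> otm) (enc : nat -> str -> str)
    (M : otm) : Prop :=
  exists c, forall n phi w t v, Reg a0 phi ->
    run (mach n) phi t w = Some v ->
    run M phi (c * n.+1 ^ 2 * t.+1) (enc n w) = Some v.

(* [None] means that the clock has aborted the simulation.  The exponent [l] only
   enlarges the clock for [1 < size w]: for [m = 0] the clock is 0 or 1 on words
   of length 0 or 1, and on the empty word it is 0 for every [m] as soon as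
   [phi'] maps the empty word to itself. *)
Definition clocked (a0 a1 : Sigma) (enc : nat -> str -> str) (M : otm) (m : nat)
    (n : nat) (phi' : str -> str) (l : nat) (w : str) : option str :=
  run M phi' (soeval (Piter m) (fsize a0 (pairn a0 a1 n phi')) (size w ^ l)) (enc n w).

End Machines.

(* Main.v *)
(** Write [p] for the size of the oracle.  A second-order polynomial of degree
    at most [m] is dominated by the [m]-fold iterate of
    [x |-> p x * (x + 2) ^ e], started at [k ^ e], once [e] is large: the factor
    [(x + 2) ^ e], which is the size of the padding oracle [psi], pays at every
    level for the polynomial overhead accumulated since the last application of
    [L].  The oracle machine for [f] is turned into one that queries
    [<phi, psi>] and decodes on the fly, reading each answer letter together
    with its marker; this costs a constant factor, which a larger [e] absorbs as
    well. *)
Require Import Defs.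
From HB Require Import structures.
From mathcomp Require Import all_boot.
From mathcomp Require Import zify.

Set Implicit Arguments.
Unset Strict Implicit.
Unset Printing Implicit Defensive.

(** * Bounding second-order polynomials *)

Lemma mon_leq p j k : mon p -> j <= k -> p j <= p k.
Proof. by move=> hp; rewrite leq_eqVlt => /predU1P[-> //|/hp/ltnW]. Qed.

Lemma mon_ge p k : mon p -> k <= p k.
Proof. by move=> hp; elim: k => // k IHk; apply: leq_ltn_trans IHk (hp _ _ _). Qed.

Lemma leq_iter (F G : nat -> nat) d x y :
  {homo G : i j / i <= j} -> (forall i, F i <= G i) -> x <= y ->
  iter d F x <= iter d G y.
Proof.
move=> hG hFG hxy; elim: d => //= d IHd.
exact: leq_trans (hFG _) (hG _ _ IHd).
Qed.

Lemma leq_expl e j k : j <= k -> j ^ e <= k ^ e.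
Proof. by case: e => // e; rewrite leq_exp2r. Qed.

(** For [p] the size of [phi], this is the size function of [phi] paired with [padding e]. *)
Definition padded (p : nat -> nat) (e x : nat) : nat := p x * (x + 2) ^ e.

Definition tower (p : nat -> nat) (e d k : nat) : nat :=
  iter d (padded p e) (k ^ e).

(* [tower p e (d - 1) k], where level [-1] is [k] itself. *)
Definition tower_pred (p : nat -> nat) (e d k : nat) : nat :=
  if d is d'.+1 then tower p e d' k else k.

Section Tower.

Variables (p : nat -> nat) (k : nat).
Hypotheses (hp : mon p) (hk : 1 < k).

Lemma leq_padded e e' x y :
  e <= e' -> x <= y -> padded p e x <= padded p e' y.
Proof.
move=> he hxy; apply: leq_mul; first exact: mon_leq.
apply: (@leq_trans ((y + 2) ^ e)); first by rewrite leq_expl ?leq_add2r.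
by rewrite leq_pexp2l // addn2.
Qed.

Lemma padded_ge e x : x <= padded p e x.
Proof. by apply: leq_trans (mon_ge x hp) _; rewrite leq_pmulr ?expn_gt0 ?addn2. Qed.

Lemma tower_ge e d : 0 < e -> k <= tower p e d k.
Proof.
move=> he; elim: d => [|d IHd]; last exact: leq_trans IHd (padded_ge _ _).
by rewrite -{1}(expn1 k) leq_pexp2l // ltnW.
Qed.

Lemma tower_pred_ge e d : 0 < e -> k <= tower_pred p e d k.
Proof. by case: d => // d; apply: tower_ge. Qed.

Lemma leq_tower e e' d d' :
  e <= e' -> d <= d' -> tower p e d k <= tower p e' d' k.
Proof.
move=> he /subnK <-; rewrite addnC.
apply: (@leq_trans (tower p e' d k)).
  apply: leq_iter => [x y|x|]; [exact: leq_padded|exact: leq_padded|].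
  by rewrite leq_pexp2l // ltnW.
elim: (d' - d) => [|j IHj]; first by rewrite addn0.
by rewrite addnS; apply: leq_trans IHj (padded_ge _ _).
Qed.

Lemma leq_tower_pred e e' d d' : 0 < e -> e <= e' -> d <= d' ->
  tower_pred p e d k <= tower_pred p e' d' k.
Proof.
move=> he0 he; case: d d' => [|d] [|d'] //= hd; last exact: leq_tower.
exact/tower_ge/(leq_trans he0).
Qed.

(** The factor [(y + 2) ^ e] of the next level absorbs the power; at level 0 both sides are
    [k ^ e]. *)
Lemma tower_predX e d : tower_pred p e d k ^ e <= tower p e d k.
Proof.
case: d => [|d] //=; rewrite /padded.
set y := tower p e d k.
have y_gt0 : 0 < y.
  rewrite /y; elim: (d) => [|j IHj]; first by rewrite expn_gt0 ltnW.
  exact: leq_trans IHj (padded_ge _ _).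
apply: (@leq_trans ((y + 2) ^ e)); first by rewrite leq_expl ?leq_addr.
by rewrite leq_pmull // (leq_trans y_gt0) ?mon_ge.
Qed.

(** [K <= x ^ K] for [1 < x], so [K] further factors in the outermost padding, or in the start value
    [k ^ e], pay for [K]. *)
Lemma tower_mull K e d : K * tower p e d k <= tower p (e + K) d k.
Proof.
have hK x : 1 < x -> K <= x ^ K by move=> hx; apply/ltnW/ltn_expl.
case: d => [|d]; first by rewrite /tower /= mulnC expnD leq_mul ?hK.
apply: (@leq_trans (padded p (e + K) (tower p e d k))); last first.
  by apply: leq_padded; rewrite ?leq_tower ?leq_addr.
rewrite /tower /= /padded mulnC -mulnA expnD !leq_mul //.
by rewrite hK // addn2.
Qed.

End Tower.

(** A product of type [m] bounds only raises the exponent, so the level stays; a product of two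
    towers is at most a power of a tower, which is the type [m] bound one level up. This mirrors the
    two cases of the degree of a product. *)
Definition sobound (x : nat * sotype) (p : nat -> nat) (e k : nat) : nat :=
  if x.2 is TypeA then tower p e x.1 k else tower_pred p e x.1 k ^ e.

Lemma sobound_tower x p e k :
  mon p -> 1 < k -> sobound x p e k <= tower p e x.1 k.
Proof. by move=> hp hk; rewrite /sobound; case: x.2; rewrite ?tower_predX. Qed.

(* A type [a] polynomial of degree below [d] costs no more than a type [m] one
   of degree [d]. *)
Lemma sobound_pred x p e e' d k : mon p -> 1 < k -> 0 < e -> e <= e' ->
  x.1 <= d -> ~~ (is_typeA x.2 && (x.1 == d)) ->
  sobound x p e k <= tower_pred p e' d k ^ e'.
Proof.
move=> hp hk he0 he; have he' := leq_trans he0 he.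
case: x => i [] /= hi; rewrite ?andbT => hd.
  have {hd}hi : i < d by rewrite ltn_neqAle hd.
  case: d hi => // d hi; rewrite /sobound /=.
  apply: leq_trans (leq_tower hp hk he (hi : i <= d)) _.
  rewrite -{1}(expn1 (tower p e' d k)) leq_pexp2l //.
  by apply: leq_trans (tower_ge hp hk d he'); apply: ltnW.
rewrite /sobound /=; apply: (@leq_trans (tower_pred p e' d k ^ e)).
  by rewrite leq_expl ?leq_tower_pred.
rewrite leq_pexp2l //.
by apply: leq_trans (tower_pred_ge hp hk d he'); apply: ltnW.
Qed.

Lemma soeval_bound P : exists2 e, 0 < e &
  forall p k, mon p -> 1 < k -> soeval P p k <= sobound (sodegtype P) p e k.
Proof.
elim: P => [c c0||Q [e1 he1 hQ] R [e2 he2 hR]|Q [e1 he1 hQ] R [e2 he2 hR]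
           |Q [e he hQ]].
- by exists c => // p k _ hk; apply/ltnW/ltn_expl.
- by exists 1 => // p k _ _; rewrite /sobound /= expn1.
(* The extra 2 in the exponent pays for the factor 2 from adding two equal bounds. *)
- pose e := maxn e1 e2; exists (e + 2); first by rewrite addn2.
  move=> p k hp hk; have {hQ} := hQ p k hp hk; have {hR} := hR p k hp hk.
  rewrite /sobound /=; set x := sodegtype Q; set y := sodegtype R => hR hQ.
  set d := maxn _ _.
  have hx : x.1 <= d by apply: leq_maxl.
  have hy : y.1 <= d by apply: leq_maxr.
  have h1 : e1 <= e by apply: leq_maxl.
  have h2 : e2 <= e by apply: leq_maxr.
  case: ifP => [_|/negbT]; last rewrite negb_or => /andP[hcx hcy].
    apply: leq_trans (tower_mull hp hk 2 e d); rewrite mul2n -addnn.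
    apply: leq_add.
      by apply/(leq_trans hQ)/(leq_trans (sobound_tower _ _ hp hk))/leq_tower.
    by apply/(leq_trans hR)/(leq_trans (sobound_tower _ _ hp hk))/leq_tower.
  have := leq_add (leq_trans hQ (sobound_pred hp hk he1 h1 hx hcx))
                  (leq_trans hR (sobound_pred hp hk he2 h2 hy hcy)).
  move/leq_trans; apply; rewrite addnn -muln2.
  have he : 0 < e by apply: leq_trans h1.
  have hg : 1 < tower_pred p e d k.
    exact: leq_trans hk (tower_pred_ge hp hk d he).
  apply: (@leq_trans (tower_pred p e d k ^ (e + 2))).
    by rewrite expnD leq_mul // (leq_trans hg) // -{1}(expn1 (tower_pred _ _ _ _)) leq_pexp2l // ltnW.
  by rewrite leq_expl // leq_tower_pred ?leq_addr.
(* Two powers [e] of the lower level multiply to the power [e + e]; in the critical case the square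
   of a tower fits because [2 <= e + e]. *)
- pose e := maxn e1 e2; exists (e + e).
    by rewrite addn_gt0 leq_max he1.
  move=> p k hp hk; have {hQ} := hQ p k hp hk; have {hR} := hR p k hp hk.
  rewrite /sobound /=; set x := sodegtype Q; set y := sodegtype R => hR hQ.
  set d := maxn _ _.
  have hx : x.1 <= d by apply: leq_maxl.
  have hy : y.1 <= d by apply: leq_maxr.
  have h1 : e1 <= e by apply: leq_maxl.
  have h2 : e2 <= e by apply: leq_maxr.
  have he : 0 < e by apply: leq_trans h1.
  case: ifP => [_|/negbT]; last rewrite negb_or => /andP[hcx hcy].
    have hQ' := leq_trans (leq_trans hQ (sobound_tower _ _ hp hk))
                          (leq_tower hp hk h1 hx).
    have hR' := leq_trans (leq_trans hR (sobound_tower _ _ hp hk))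
                          (leq_tower hp hk h2 hy).
    apply: leq_trans (leq_mul hQ' hR') _.
    rewrite mulnn.
    apply: (@leq_trans (tower p (e + e) d k ^ 2)).
      by rewrite leq_exp2r // leq_tower ?leq_addr.
    rewrite leq_pexp2l //; last by rewrite addnn -mul2n leq_pmulr.
    apply: leq_trans (tower_ge hp hk _ _); first exact: ltnW.
    by rewrite addn_gt0 he.
  have := leq_mul (leq_trans hQ (sobound_pred hp hk he1 h1 hx hcx))
                  (leq_trans hR (sobound_pred hp hk he2 h2 hy hcy)).
  move/leq_trans; apply; rewrite -expnD leq_expl //.
  by rewrite leq_tower_pred ?leq_addr.
- exists e => // p k hp hk; rewrite /sobound /=.
  apply: (@leq_trans (p (tower p e (sodegtype Q).1 k))).
    by apply: mon_leq => //; apply: leq_trans (hQ _ _ hp hk) (sobound_tower _ _ hp hk).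
  by rewrite leq_pmulr // expn_gt0 addn2.
Qed.

(** * Decoding the answers of a paired oracle *)

Section Coded.

Variables (Sigma : finType) (a0 a1 : Sigma).

Local Notation str := (seq Sigma).

(* The second alternative is needed because [spair] cuts the code of the empty
   word to the empty word. *)
Definition coded (u s : str) : Prop :=
  (exists r, s = code a0 a1 u ++ r) \/ (u = [::] /\ s = [::]).

(** Since [2 < size v], the code of a nonempty [u], of length [2 |u| + 1], survives the cut to
    [|u| |v|]. *)
Lemma coded_spair u v : 2 < size v -> coded u (spair a0 a1 u v).
Proof.
case: u => [|x u] hv; first by right; rewrite /spair mul0n take0.
left; rewrite /spair take_cat size_code; case: ltnP => [|_]; last by eexists.
by rewrite /=; nia.
Qed.

Lemma nth_code_marker u r i : i <= size u ->
  nth None (map Some (code a0 a1 u ++ r)) i.*2 =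
    Some (if i < size u then a1 else a0).
Proof. by elim: u i => [|x u IHu] [|i] //= /IHu. Qed.

Lemma nth_code_letter u r i : i < size u ->
  nth None (map Some (code a0 a1 u ++ r)) i.*2.+1 = nth None (map Some u) i.
Proof. by elim: u i => [|x u IHu] [|i] //= /IHu. Qed.

(* Answer cell [i] is represented by the head standing on the marker [2 i - 1]. *)
Definition ans_rel (T T' : rotape Sigma) : Prop :=
  [/\ coded (ro_word T) (ro_word T'), ro_pos T <= (size (ro_word T)).+1 &
      ro_pos T' = (ro_pos T).*2.-1].

Lemma ans_rel_init u s : coded u s -> ans_rel (ro_init u) (ro_init s).
Proof. by []. Qed.

(** The letter of cell [i] sits at [2 i]; the markers of cells [i - 1], [i], [i + 1] are 3 and 1
    steps to its left and 1 step to its right. *)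
Definition letter_return (d : move) (T : rotape Sigma) : rotape Sigma :=
  match d with
  | MLeft => iter 3 (@ro_move Sigma MLeft) T
  | MStay => ro_move MLeft T
  | MRight => ro_move MRight T
  end.

(** From the left end cell a right move goes to the first marker; at the terminating [a0] it is
    blocked, just as the simulated head is at its right end. *)
Definition end_return (d : move) (T : rotape Sigma) : rotape Sigma :=
  match d with
  | MLeft => iter 2 (@ro_move Sigma MLeft) T
  | MStay => T
  | MRight => if ro_read T is None then ro_move MRight T else T
  end.

Lemma ans_rel_letter T T' d : a0 != a1 -> ans_rel T T' -> ro_read T' = Some a1 ->
  ro_read (ro_move MRight T') = ro_read T /\
  ans_rel (ro_move d T) (letter_return d (ro_move MRight T')).
Proof.
move=> ha; case: T T' => u p [s p'] [/= [[r ->]|[-> ->]] hp ->]; rewrite /ro_read /=; last first.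
  by case: (p.*2.-1) => [|[|]].
case: p hp => [//|i]; rewrite ltnS doubleS /= => hi.
rewrite nth_code_marker //; case: ltnP => [hlt _|_ [h]]; last by move: ha; rewrite h eqxx.
have hs : i.*2.+2 <= size (code a0 a1 u ++ r) by rewrite size_cat size_code; lia.
rewrite (minn_idPl (leqW hs)) /= nth_code_letter //; split=> //.
split; [by case: d; left; exists r| |]; case: d => /=; lia.
Qed.

Lemma ans_rel_end T T' d : ans_rel T T' -> ro_read T' <> Some a1 ->
  ro_read T = None /\ ans_rel (ro_move d T) (end_return d T').
Proof.
case: T T' => u p [s p'] [/= [[r ->]|[-> ->]] hp ->]; last first.
  case: p hp => [|[|//]] _ _; split=> //; by split; case: d => //; right.
case: p hp => [_ _|i].
  split=> //; split; [by case: d; left; exists r| |]; case: d => //=; lia.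
rewrite ltnS doubleS /ro_read /= => hi.
rewrite nth_code_marker //; case: ltnP => // hge _.
have {hi hge}-> : i = size u by lia.
split; first by rewrite nth_default ?size_map.
have -> : end_return d (ROTape (code a0 a1 u ++ r) (size u).*2.+1) =
    ROTape (code a0 a1 u ++ r)
      (if d is MLeft then (size u).*2.-1 else (size u).*2.+1).
  by case: d => //=; rewrite /ro_read /= nth_code_marker.
split; [by left; exists r| |]; case: d => /=; lia.
Qed.

End Coded.

(** * Determinism of runs and monotonicity in the number of steps *)

Section Runs.

Variables (Sigma : finType) (N : otm Sigma) (phi : seq Sigma -> seq Sigma).

Lemma run_from_halt t (c : config N) :
  step phi c = None -> run_from phi t c = Some (c_out c).
Proof. by case: t => [|t] /= ->. Qed.

Lemma run_fromS t (c c' : config N) :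
  step phi c = Some c' -> run_from phi t.+1 c = run_from phi t c'.
Proof. by move=> /= ->. Qed.

Lemma run_from_leq t t' (c : config N) v :
  t <= t' -> run_from phi t c = Some v -> run_from phi t' c = Some v.
Proof.
elim: t t' c => [|t IHt] [|t'] c //=; case: (step phi c) => // c' htt'.
exact: IHt.
Qed.

Lemma run_leq t t' w v :
  t <= t' -> run N phi t w = Some v -> run N phi t' w = Some v.
Proof. exact: run_from_leq. Qed.

Lemma outputs_run t w v v' :
  outputs N phi w v -> run N phi t w = Some v' -> v' = v.
Proof.
case=> t' h h'; apply/esym/Some_inj.
by rewrite -(run_leq (leq_maxl t' t) h) (run_leq (leq_maxr t' t) h').
Qed.

End Runs.

(* [Back1] and [Back2] are for the left moves still due before the answer head
   is again on a marker. *)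
Inductive phase := Marker | Letter | Back1 | Back2.

Definition phase_code (ph : phase) : bool * bool :=
  match ph with
  | Marker => (false, false)
  | Letter => (false, true)
  | Back1 => (true, false)
  | Back2 => (true, true)
  end.

Definition phase_decode (b : bool * bool) : phase :=
  if b.1 then (if b.2 then Back2 else Back1) else (if b.2 then Letter else Marker).

Lemma phase_codeK : cancel phase_code phase_decode.
Proof. by case. Qed.

HB.instance Definition _ := Finite.copy phase (can_type phase_codeK).

(** * The decoding machine and its simulation of [N] *)

Section Decoder.

Variables (Sigma : finType) (a0 a1 : Sigma) (ha : a0 != a1) (N : otm Sigma).

Local Notation dstate := ('I_(nstates N) * phase)%type.

(** The first move is carried out together with the simulated instruction; the phase records what
    then remains of [letter_return] or [end_return]. *)
Definition dec_move (ph : phase) (b : option Sigma) (d : move) : move * phase :=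
  match ph, d with
  | Letter, MLeft => (MLeft, Back2)
  | Letter, MStay => (MLeft, Marker)
  | Letter, MRight => (MRight, Marker)
  | _, MLeft => (MLeft, Back1)
  | _, MStay => (MStay, Marker)
  | _, MRight => (if b is None then MRight else MStay, Marker)
  end.

Definition dec_instr (ph : phase) (b : option Sigma)
    (i : instr Sigma (nstates N) (nsyms N)) : instr Sigma #|{: dstate}| (nsyms N) :=
  let x := dec_move ph b (ans_move i) in
  Instr (enum_rank (next_state i, if ask i then Marker else x.2))
    (in_move i) x.1 (work_write i) (work_move i) (query_put i) (out_put i) (ask i).

Definition walk_instr (q : 'I_(nstates N)) (ph : phase) (d : move)
    (g : 'I_(nsyms N)) : instr Sigma #|{: dstate}| (nsyms N) :=
  Instr (enum_rank (q, ph)) MStay d g MStay None None false.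

(** In phase [Marker], a symbol other than [a1] means that the simulated head is at an end of its
    tape, so [N] is shown [None]. *)
Definition dec_delta (q : 'I_(nstates N)) (ph : phase) (a b : option Sigma)
    (g : 'I_(nsyms N)) : option (instr Sigma #|{: dstate}| (nsyms N)) :=
  match ph with
  | Marker =>
      if b == Some a1 then Some (walk_instr q Letter MRight g)
      else omap (dec_instr Marker b) (delta N (q, a, None, g))
  | Letter => omap (dec_instr Letter b) (delta N (q, a, b, g))
  | Back1 => Some (walk_instr q Marker MLeft g)
  | Back2 => Some (walk_instr q Back1 MLeft g)
  end.

Definition decoder : otm Sigma :=
  @OTM Sigma #|{: dstate}| (nsyms N) (enum_rank (start_state N, Marker))
    (blank_sym N)
    [ffun x => let: (s, a, b, g) := x in
               let: (q, ph) := enum_val s in dec_delta q ph a b g].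

Definition lift_config (c : config N) (ph : phase) (T : rotape Sigma) :
    config decoder :=
  @Config Sigma decoder (enum_rank (c_state c, ph)) (c_in c) T (c_work c)
    (c_query c) (c_out c).

Lemma delta_decoder q ph a b g :
  delta decoder (enum_rank (q, ph), a, b, g) = dec_delta q ph a b g.
Proof. by rewrite /= ffunE enum_rankK. Qed.

Variables (phi phi' : seq Sigma -> seq Sigma).

Lemma step_walk c ph ph' d T :
  dec_delta (c_state c) ph (ro_read (c_in c)) (ro_read T) (wcur (c_work c)) =
    Some (walk_instr (c_state c) ph' d (wcur (c_work c))) ->
  step phi' (lift_config c ph T) = Some (lift_config c ph' (ro_move d T)).
Proof.
rewrite /step delta_decoder => ->; congr Some.
by rewrite /lift_config; case: c => ? [? ?] ? [? ? ?] ? ?.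
Qed.

Definition unwind (ph : phase) (T : rotape Sigma) : rotape Sigma :=
  match ph with
  | Back1 => ro_move MLeft T
  | Back2 => ro_move MLeft (ro_move MLeft T)
  | _ => T
  end.

Lemma run_unwind t c ph T v : ph != Letter ->
  run_from phi' t (lift_config c Marker (unwind ph T)) = Some v ->
  run_from phi' t.+2 (lift_config c ph T) = Some v.
Proof.
have back1 T0 : step phi' (lift_config c Back1 T0) =
    Some (lift_config c Marker (ro_move MLeft T0)) by apply: step_walk.
have back2 T0 : step phi' (lift_config c Back2 T0) =
    Some (lift_config c Back1 (ro_move MLeft T0)) by apply: step_walk.
case: ph => // _ h; first exact: run_from_leq (leqW (leqW (leqnn t))) h.
  by rewrite (run_fromS _ (back1 _)); apply: run_from_leq h.
by rewrite (run_fromS _ (back2 _)) (run_fromS _ (back1 _)).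
Qed.

Hypothesis hphi : forall q, coded a0 a1 (phi q) (phi' q).

(** Three steps suffice: the instruction itself and at most two left moves still due. *)
Lemma dec_step c ph T i :
  delta N (c_state c, ro_read (c_in c), ro_read (c_ans c), wcur (c_work c)) =
    Some i ->
  dec_delta (c_state c) ph (ro_read (c_in c)) (ro_read T) (wcur (c_work c)) =
    Some (dec_instr ph (ro_read T) i) ->
  ans_rel a0 a1 (ro_move (ans_move i) (c_ans c))
    (unwind (dec_move ph (ro_read T) (ans_move i)).2
       (ro_move (dec_move ph (ro_read T) (ans_move i)).1 T)) ->
  exists c1 T1,
    [/\ step phi c = Some c1, ans_rel a0 a1 (c_ans c1) T1 &
        forall t v, run_from phi' t (lift_config c1 Marker T1) = Some v ->
          run_from phi' t.+3 (lift_config c ph T) = Some v].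
Proof.
move=> hN hD hT.
have := erefl (step phi c); rewrite {2}/step hN; set c1 := Config _ _ _ _ _ _ => hc1.
set q := put (query_put i) (c_query c) in c1 hc1.
pose x := dec_move ph (ro_read T) (ans_move i).
pose ph1 := if ask i then Marker else x.2.
pose T1 := if ask i then ro_init (phi' q) else ro_move x.1 T.
have hs : step phi' (lift_config c ph T) = Some (lift_config c1 ph1 T1).
  by rewrite /step delta_decoder hD.
exists c1, (unwind ph1 T1); split=> // [|t v hv].
  by rewrite /ph1 /T1 /=; case: (ask i) => //=; apply: ans_rel_init.
rewrite (run_fromS _ hs); apply: run_unwind hv.
by rewrite /ph1 /x; case: (ask i); case: (ph); case: (ans_move i).
Qed.

(** Visiting the letter may cost one step before the instruction, so one step of [N] takes at most
    four; a halting configuration may need that visit as well. *)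
Lemma decoder_step c T : ans_rel a0 a1 (c_ans c) T ->
  if step phi c is Some c1 then
    exists2 T1, ans_rel a0 a1 (c_ans c1) T1 &
      forall t v, run_from phi' t (lift_config c1 Marker T1) = Some v ->
        run_from phi' t.+4 (lift_config c Marker T) = Some v
  else forall t, run_from phi' t.+1 (lift_config c Marker T) = Some (c_out c).
Proof.
move=> hT; have [ra|/eqP ra] := eqVneq (ro_read T) (Some a1).
  have hs : step phi' (lift_config c Marker T) =
      Some (lift_config c Letter (ro_move MRight T)).
    by apply: step_walk; rewrite /dec_delta ra eqxx.
  have hr d := (ans_rel_letter d ha hT ra).2.
  have rT : ro_read (ro_move MRight T) = ro_read (c_ans c).
    by have [] := ans_rel_letter MStay ha hT ra.
  case hN : (delta N (c_state c, ro_read (c_in c), ro_read (c_ans c),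
                      wcur (c_work c))) => [i|].
    have [||c1 [T1 [-> h1 hrun]]] := dec_step (ph := Letter) (T := ro_move MRight T) hN.
    - by rewrite /= rT hN.
    - by have := hr (ans_move i); case: (ans_move i).
    exists T1 => // t v /hrun hv.
    by rewrite (run_fromS _ hs).
  rewrite /step hN => t; rewrite (run_fromS _ hs).
  by rewrite run_from_halt // /step delta_decoder /= rT hN.
have hr d := (ans_rel_end d hT ra).2.
have rT : ro_read (c_ans c) = None by have [] := ans_rel_end MStay hT ra.
case hN : (delta N (c_state c, ro_read (c_in c), ro_read (c_ans c),
                    wcur (c_work c))) => [i|].
  have [||c1 [T1 [-> h1 hrun]]] := dec_step (ph := Marker) (T := T) hN.
  - by rewrite /= (introF eqP ra) -rT hN.
  - have stay : ro_move MStay T = T by case: (T).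
    have := hr (ans_move i); case: (ans_move i) => //=; first by rewrite stay.
    by case: (ro_read T) => //= x; rewrite stay.
  exists T1 => // t v /hrun; exact: run_from_leq.
rewrite /step hN => t.
by rewrite run_from_halt // /step delta_decoder /= (introF eqP ra) -rT hN.
Qed.

(** The additional step allows for a last visit to a letter before halting. *)
Lemma run_from_decoder t c T v : ans_rel a0 a1 (c_ans c) T ->
  run_from phi t c = Some v ->
  run_from phi' (4 * t).+1 (lift_config c Marker T) = Some v.
Proof.
elim: t c T => [|t IHt] c T /decoder_step; case hs: (step phi c) => [c1|].
- by rewrite /= hs.
- by rewrite run_from_halt // => h [<-].
- by case=> T1 h1 hrun; rewrite (run_fromS _ hs) mulnS => /(IHt _ _ h1)/hrun.
- by rewrite run_from_halt // => h [<-].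
Qed.

Lemma run_decoder t w v :
  run N phi t w = Some v -> run decoder phi' (4 * t).+1 w = Some v.
(* Before the first oracle call both answer tapes are empty: the second alternative of [coded]. *)
Proof. by apply: run_from_decoder; apply: ans_rel_init; right. Qed.

End Decoder.

(** * The padding oracle *)

Section Padding.

Variables (Sigma : finType) (a0 a1 : Sigma).

Definition padding (e : nat) (u : seq Sigma) : seq Sigma :=
  nseq ((size u + 2) ^ e) a0.

Lemma fsize_padding e k : fsize a0 (padding e) k = (k + 2) ^ e.
Proof. by rewrite /fsize !size_nseq. Qed.

Lemma Reg_padding e : 0 < e -> Reg a0 (padding e).
Proof.
move=> he; split=> [u v huv|j k hjk].
  by rewrite !size_nseq leq_expl ?leq_add2r.
by rewrite !fsize_padding ltn_exp2r ?ltn_add2r.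
Qed.

Lemma fsize_pairf phi psi k :
  fsize a0 (pairf a0 a1 phi psi) k = fsize a0 phi k * fsize a0 psi k.
Proof. exact: size_spair. Qed.

Lemma Reg_pairf phi psi : (forall k, 0 < fsize a0 psi k) ->
  Reg a0 phi -> Reg a0 psi -> Reg a0 (pairf a0 a1 phi psi).
Proof.
move=> hpos [rphi mphi] [rpsi mpsi]; split=> [u v huv|j k hjk].
  by rewrite !size_spair leq_mul ?rphi ?rpsi.
(* Strict growth in [phi] is kept because the size of [psi] at [k] is positive. *)
rewrite !fsize_pairf; apply: (@leq_ltn_trans (fsize a0 phi j * fsize a0 psi k)).
  by rewrite leq_mul // ltnW ?mpsi.
by rewrite ltn_pmul2r ?mphi.
Qed.

Lemma soeval_Piter m q k : soeval (Piter m) q k = iter m q k.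
Proof. by elim: m => //= m ->. Qed.

(** The length of the numeral of [n] is a positive factor of the oracle size, so it can only enlarge
    the clock. *)
Lemma tower_clock m n phi e k : Reg a0 phi ->
  tower (fsize a0 phi) e m k <=
  soeval (Piter m) (fsize a0 (pairn a0 a1 n (pairf a0 a1 phi (padding e)))) (k ^ e).
Proof.
move=> [_ mphi]; rewrite soeval_Piter.
have fE i : fsize a0 (pairn a0 a1 n (pairf a0 a1 phi (padding e))) i =
    (trunc_log 2 n).+1 * padded (fsize a0 phi) e i.
  rewrite /fsize size_spair size_mkseq; congr (_ * _).
  by rewrite -/(fsize _ _ i) fsize_pairf fsize_padding.
apply: leq_iter => // [i j hij|i]; rewrite !fE ?leq_pmull //.
by rewrite leq_mul // leq_padded.
Qed.

End Padding.

Theorem theorem16 (Sigma : finType) (a0 a1 : Sigma) (ha : a0 != a1)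
    (mach : nat -> otm Sigma) (hmach : numbering mach)
    (enc : nat -> seq Sigma -> seq Sigma) (M : otm Sigma)
    (huniv : universal a0 mach enc M) (heff : efficient a0 mach enc M)
    (m : nat)
    (dom : (seq Sigma -> seq Sigma) -> Prop)
    (f : (seq Sigma -> seq Sigma) -> (seq Sigma -> seq Sigma))
    (hdom : forall phi, dom phi -> Reg a0 phi)
    (hf : forall phi, dom phi -> Reg a0 (f phi))
    (N : otm Sigma) (P : sopoly)
    (hN : computes N dom f) (hP : time_bounded a0 N P) (hdeg : sodeg P <= m) :
  exists (psi : seq Sigma -> seq Sigma) (n l : nat),
    [/\ Reg a0 psi, mon (fun x => x ^ l) &
        forall phi, dom phi ->
          (forall w, 1 < size w ->
             clocked a0 a1 enc M m n (pairf a0 a1 phi psi) l w = Some (f phi w)) /\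
          (forall w, outputs M (pairf a0 a1 phi psi) (enc n w) (f phi w))].
Proof.
(* The decoder does not depend on the padding, so its index may enter the exponent [l]. *)
have [n hn] := hmach (decoder a1 N).
have [c hc] := heff.
have [e he hPe] := soeval_bound P.
(* With [T] the time bound for [N], the simulation takes [c * n.+1 ^ 2 * (4 T + 2)] steps, and
   [4 T + 2] is at most 6 times the tower, which is positive. In [l], [e] serves to dominate [P],
   [K] absorbs the factor, and the successor makes [l] at least 2. *)
pose K := 6 * (c * n.+1 ^ 2); pose l := (e + K).+1.
exists (padding a0 l), n, l; split; first exact: Reg_padding.
  by move=> j k hjk; rewrite ltn_exp2r.
move=> phi hphi; have rphi := hdom phi hphi.
have [_ mphi] := rphi.
set phi' := pairf _ _ _ _.
have rphi' : Reg a0 phi'.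
  apply: Reg_pairf => // [k|]; last exact: Reg_padding.
  by rewrite fsize_padding expn_gt0 addn2.
have hcod q : coded a0 a1 (phi q) (phi' q).
  apply: coded_spair; rewrite size_nseq.
  (* As [l] is at least 2, every padding word has at least 4 letters. *)
  apply: (@leq_trans (2 ^ 2)) => //; apply: (@leq_trans (2 ^ l)).
    by rewrite leq_pexp2l // ltnS addn_gt0 he.
  by rewrite leq_expl ?leq_addl.
have hrun w : run M phi' (c * n.+1 ^ 2 *
    (4 * soeval P (fsize a0 phi) (size w)).+2) (enc n w) = Some (f phi w).
  apply: hc => //; rewrite hn; apply: (run_decoder ha hcod).
  have [v hv] := hP phi w rphi.
  (* [hP] only yields some output within the bound; determinism identifies it with [f phi w]. *)
  by rewrite hv (outputs_run (hN phi hphi w) hv).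
split=> w; last by eexists; apply: hrun.
move=> hw; apply: run_leq (hrun w).
apply: leq_trans (tower_clock a1 m n l (size w) rphi).
apply: (@leq_trans (K * tower (fsize a0 phi) e m (size w))); last first.
  apply: leq_trans (tower_mull mphi hw K e m) _.
  exact: leq_tower.
have hPm : soeval P (fsize a0 phi) (size w) <= tower (fsize a0 phi) e m (size w).
  apply: leq_trans (hPe _ _ mphi hw) _.
  apply: leq_trans (sobound_tower _ _ mphi hw) _.
  exact: leq_tower.
have hpos := leq_trans (ltnW hw) (tower_ge mphi hw m he).
rewrite /K; set A := c * n.+1 ^ 2; rewrite -mulnA mulnCA leq_mul //; lia.
Qed.
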